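(* Let $A$ and $B$ be $0$-$1$ matrices, neither of which is all-zero, and let $P=\begin{pmatrix} A & \mathbf{0}\\ \mathbf{0} & B\end{pmatrix}$, where the $\mathbf{0}$ blocks are all-zero matrices of the appropriate sizes. Then $sat(P,n)=\Theta(n)$.
   Context: All matrices are $0$-$1$ matrices; an $m\times n$ matrix has $m$ rows and $n$ columns. The weight of a matrix is its number of $1$ entries. A matrix $M$ contains a $k\times l$ pattern $P$ if there are rows $r_1<\dots<r_k$ and columns $c_1<\dots<c_l$ of $M$ such that $M(r_a,c_b)=1$ whenever $P(a,b)=1$; otherwise $M$ avoids $P$. A matrix $M$ is saturating for $P$ if $M$ avoids $P$ and changing any single $0$ entry of $M$ to $1$ yields a matrix containing $P$. $sat(P,m,n)$ is the minimum weight of an $m\times n$ matrix saturating for $P$, and $sat(P,n)=sat(P,n,n)$. *)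

(* Defs.v *)
From mathcomp Require Import all_boot all_order all_algebra.

Set Implicit Arguments.
Unset Strict Implicit.
Unset Printing Implicit Defensive.

(* A 0-1 matrix is a matrix over bool. *)

Definition weight m n (M : 'M[bool]_(m, n)) : nat :=
  #|[set ij : 'I_m * 'I_n | M ij.1 ij.2]|.

Definition increasing k m (r : {ffun 'I_k -> 'I_m}) : bool :=
  [forall a : 'I_k, forall b : 'I_k, (a < b) ==> (r a < r b)].

Definition contains k l m n (P : 'M[bool]_(k, l)) (M : 'M[bool]_(m, n)) : bool :=
  [exists r : {ffun 'I_k -> 'I_m}, exists c : {ffun 'I_l -> 'I_n},
    [&& increasing r, increasing c &
      [forall a, forall b, P a b ==> M (r a) (c b)]]].

Definition set_one m n (M : 'M[bool]_(m, n)) (i : 'I_m) (j : 'I_n) :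
    'M[bool]_(m, n) :=
  \matrix_(i', j') (((i', j') == (i, j)) || M i' j').

Definition saturating k l m n (P : 'M[bool]_(k, l)) (M : 'M[bool]_(m, n)) : bool :=
  ~~ contains P M &&
  [forall i, forall j, ~~ M i j ==> contains P (set_one M i j)].

(* The default value m * n bounds every weight, so it never lowers the minimum;
   it is the value only when no matrix is saturating (or all of them are full).
   satP shows it is an attained minimum whenever P is not all-zero. *)
Definition sat k l (P : 'M[bool]_(k, l)) (m n : nat) : nat :=
  \big[minn/(m * n)%N]_(M : 'M[bool]_(m, n) | saturating P M) weight M.

Lemma weight_le m n (M : 'M[bool]_(m, n)) : weight M <= m * n.
Proof. by rewrite (leq_trans (max_card _)) // card_prod !card_ord. Qed.

Lemma sat_le k l (P : 'M[bool]_(k, l)) m n (M : 'M[bool]_(m, n)) :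
  saturating P M -> sat P m n <= weight M.
Proof.
move=> sM; rewrite /sat; have := mem_index_enum M.
elim: (index_enum _) => // N s IHs; rewrite inE big_cons => /orP[/eqP <-|/IHs le].
  by rewrite sM geq_minl.
by case: ifP => // _; rewrite geq_min le orbT.
Qed.

Lemma saturating_exists k l (P : 'M[bool]_(k, l)) m n :
  P != const_mx false -> exists M : 'M[bool]_(m, n), saturating P M.
Proof.
move=> P0; pose Z : 'M[bool]_(m, n) := const_mx false.
have avZ : ~~ contains P Z.
  apply: contra P0 => /existsP[r /existsP[c /and3P[_ _ /forallP H]]].
  apply/eqP/matrixP => a b; rewrite mxE; apply/negbTE/negP => Pab.
  by move/forallP: (H a) => /(_ b); rewrite Pab mxE.
case: (@arg_maxnP _ Z (fun M : 'M[bool]_(m, n) => ~~ contains P M)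
  (@weight m n) avZ) => M avM maxM.
exists M; rewrite /saturating avM /=.
apply/forallP => i; apply/forallP => j; apply/implyP => Mij.
rewrite -[contains _ _]negbK; apply/negP => /maxM /=.
apply/negP; rewrite -ltnNge; apply: proper_card; apply/properP; split.
  by apply/subsetP => -[a b]; rewrite !inE /= mxE => ->; rewrite orbT.
by exists (i, j); rewrite !inE /= ?mxE ?eqxx // (negbTE Mij).
Qed.

Lemma satP k l (P : 'M[bool]_(k, l)) m n : P != const_mx false ->
  exists2 M : 'M[bool]_(m, n), saturating P M & sat P m n = weight M.
Proof.
move=> /(@saturating_exists _ _ P m n)[M0 sM0].
case: (@arg_minnP _ M0 (fun M : 'M[bool]_(m, n) => saturating P M)
  (@weight m n) sM0) => M sM minM.
exists M => //; apply/eqP; rewrite eqn_leq sat_le //=.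
rewrite /sat; elim/big_ind: _ => [|x y hx hy|N /minM//]; first exact: weight_le.
by rewrite leq_min hx hy.
Qed.

(* Main.v *)
(* Lower bound: no column [j] of a saturating matrix [M] is empty. Otherwise
   filling [(i, j)] creates a copy of [P] for every [i], so [M] has a copy of [B]
   strictly below and to the right of [(i, j)], or a copy of [A] strictly above
   and to the left. The top row is of the first kind and the bottom row is not,
   so two consecutive rows are of the first and the second kind; the two copies
   together form [P] in [M].
   Upper bound: if [P a b = 1], the matrix whose ones are the [a] first and
   [k - 1 - a] last rows and the [b] first and [l - 1 - b] last columns is
   saturating: the entry [(a, b)] of a copy of [P] cannot lie on this frame, and
   all the other entries can. *)
Require Import Defs.
From mathcomp Require Import all_boot all_order all_algebra.
From mathcomp Require Import zify.

Set Implicit Arguments.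
Unset Strict Implicit.
Unset Printing Implicit Defensive.

(** * Increasing index maps and occurrences of a pattern *)

Lemma increasingP k m (r : {ffun 'I_k -> 'I_m}) :
  reflect {homo r : a b / a < b} (increasing r).
Proof.
apply: (iffP forallP) => [H a b ab|H a].
  by move/forallP: (H a) => /(_ b); rewrite ab.
by apply/forallP => b; apply/implyP; apply: H.
Qed.

Lemma increasing_geq k m (r : {ffun 'I_k -> 'I_m}) (a : 'I_k) :
  increasing r -> a <= r a.
Proof.
move=> /increasingP hr; case: a => x; elim: x => [|x IH] hx //=.
exact: leq_ltn_trans (IH (ltnW hx)) (hr (Ordinal (ltnW hx)) (Ordinal hx) _).
Qed.

Lemma increasing_leq k m (r : {ffun 'I_k -> 'I_m}) (a : 'I_k) :
  increasing r -> r a + (k.-1 - a) < m.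
Proof.
move=> /increasingP hr; have [d def_d] : exists d, d = k.-1 - a by eexists.
rewrite -def_d; elim: d a def_d => [|d IH] a def_d; first by rewrite addn0.
have ha : a.+1 < k by lia.
have := IH (Ordinal ha) _; have := hr a (Ordinal ha) (ltnSn _) => /=; lia.
Qed.

Definition occurs k l m n (P : 'M[bool]_(k, l)) (M : 'M[bool]_(m, n))
    (r : {ffun 'I_k -> 'I_m}) (c : {ffun 'I_l -> 'I_n}) : Prop :=
  [/\ {homo r : a b / a < b}, {homo c : a b / a < b} &
      forall a b, P a b -> M (r a) (c b)].

Lemma containsP k l m n (P : 'M[bool]_(k, l)) (M : 'M[bool]_(m, n)) :
  reflect (exists r c, occurs P M r c) (contains P M).
Proof.
apply: (iffP existsP) => -[r].
  move=> /existsP[c /and3P[/increasingP hr /increasingP hc /forallP H]].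
  exists r, c; split=> // a b Pab.
  by move/forallP: (H a) => /(_ b); rewrite Pab.
case=> c [hr hc H]; exists r; apply/existsP; exists c.
apply/and3P; split; [exact/increasingP|exact/increasingP|].
by apply/forallP => a; apply/forallP => b; apply/implyP; apply: H.
Qed.

Lemma neq0_entry k l (P : 'M[bool]_(k, l)) :
  P != const_mx false -> exists a b, P a b.
Proof.
have [/existsP[a /existsP[b Pab]]|no] := boolP [exists a, exists b, P a b].
  by exists a, b.
case/eqP; apply/matrixP => a b; rewrite mxE; apply: contraNF no => Pab.
by apply/existsP; exists a; apply/existsP; exists b.
Qed.

(** * Upper bound: the margin of an index and the frame *)

Definition margin k m (a : 'I_k) (i : nat) : bool :=
  (i < a) || (m <= i + (k.-1 - a)).

(** [x] values of [r] lie before [r x] and [k.-1 - x] lie after it, so [r x] keeps that much room at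
    both ends. *)
Lemma increasing_notin_margin k m (x : 'I_k) (r : {ffun 'I_k -> 'I_m}) :
  increasing r -> margin m x (r x) = false.
Proof.
move=> hr; have := increasing_geq x hr; have := increasing_leq x hr.
rewrite /margin; lia.
Qed.

Lemma margin_embedding k m (x : 'I_k) (i : 'I_m) : ~~ margin m x i ->
  exists2 r : {ffun 'I_k -> 'I_m}, {homo r : y z / y < z} &
    r x = i /\ forall y, y != x -> margin m x (r y).
Proof.
rewrite /margin negb_or -leqNgt -ltnNge => /andP[xi im].
(* Indices before [x] are packed at the start of ['I_m], those after [x] at its end. As [i] is
   outside the margin, [k <= m], so [m - k] is not truncated and [i] fits between the two groups. *)
pose f (y : nat) := if y == x then i : nat else if y < x then y else m - k + y.
have hx := ltn_ord x.
have fm (y : 'I_k) : f y < m.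
  rewrite /f; have := ltn_ord y; have := ltn_ord i.
  case: eqP => [//|?]; case: (ltnP y x); lia.
have xE y : (y == x) = (y == x :> nat) by [].
exists [ffun y => Ordinal (fm y)].
  move=> y z yz; rewrite !ffunE /= /f; have := ltn_ord y; have := ltn_ord z.
  case: (eqVneq (y : nat) x) => ?; case: (eqVneq (z : nat) x) => ?;
    case: (ltnP y x) => ?; case: (ltnP z x); lia.
split=> [|y]; first by rewrite ffunE; apply: val_inj; rewrite /= /f eqxx.
rewrite xE ffunE /= /f => /negbTE yx; rewrite yx; have := ltn_ord y.
move/eqP: yx; case: (ltnP y x); lia.
Qed.

Lemma card_margin k m (x : 'I_k) : #|[set i : 'I_m | margin m x i]| <= k + k.
Proof.
(* The first [k] and last [k] positions cover the margin; if [m < k], the truncated [m - k] is [0]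
   and [s] still covers all of ['I_m]. *)
pose s := iota 0 k ++ iota (m - k) k.
rewrite cardE -(size_map val) (@leq_trans (size s)) //; last first.
  by rewrite size_cat !size_iota.
apply: uniq_leq_size; first by rewrite map_inj_uniq ?enum_uniq //; apply: val_inj.
move=> _ /mapP[i + ->]; rewrite mem_enum inE mem_cat !mem_iota /margin /=.
have := ltn_ord i; have := ltn_ord x; lia.
Qed.

Section Frame.

Variables (k l : nat) (P : 'M[bool]_(k, l)) (a : 'I_k) (b : 'I_l).
Hypothesis Pab : P a b.

Definition frame m n : 'M[bool]_(m, n) :=
  \matrix_(i, j) (margin m a i || margin n b j).

Lemma frame_saturating m n : saturating P (frame m n).
Proof.
apply/andP; split.
  apply/negP => /containsP[r [c [/increasingP hr /increasingP hc /(_ a b Pab)]]].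
  by rewrite mxE !increasing_notin_margin.
apply/forallP => i; apply/forallP => j; apply/implyP; rewrite mxE negb_or.
case/andP=> /margin_embedding[r hr [ra rM]] /margin_embedding[c hc [cb cM]].
apply/containsP; exists r, c; split=> // x y _; rewrite !mxE.
(* Entries off row [a] land in margin rows, those off column [b] in margin columns, and [(a, b)]
   lands on the added one at [(i, j)]. *)
case: (eqVneq x a) => [->|/rM ->]; last by rewrite orbT.
by case: (eqVneq y b) => [->|/cM ->]; rewrite ?orbT // ra cb eqxx.
Qed.

Lemma weight_frame n : weight (frame n n) <= (k + k + (l + l)) * n.
Proof.
pose I := [set i : 'I_n | margin n a i]; pose J := [set j : 'I_n | margin n b j].
(* The ones fill the rows in [I] and the columns in [J], at most [k + k] and [l + l] lines of length
   [n]. *)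
apply: (@leq_trans #|setX I setT :|: setX setT J|).
  by apply/subset_leq_card/subsetP => -[i j]; rewrite !inE mxE /= andbT.
rewrite (leq_trans (leq_card_setU _ _)) // !cardsX cardsT card_ord mulnDl.
by rewrite leq_add // ?[n * _]mulnC leq_mul ?card_margin.
Qed.

End Frame.

Lemma sat_leq_linear k l (P : 'M[bool]_(k, l)) : P != const_mx false ->
  forall n, sat P n n <= (k + k + (l + l)) * n.
Proof.
move=> /neq0_entry[a [b Pab]] n.
exact: leq_trans (sat_le (frame_saturating Pab n n)) (weight_frame a b n).
Qed.

(** * Lower bound: joining and separating copies of the two blocks *)

Definition glue p q m (f : {ffun 'I_p -> 'I_m}) (g : {ffun 'I_q -> 'I_m}) :
    {ffun 'I_(p + q) -> 'I_m} :=
  [ffun x => match split x with inl y => f y | inr z => g z end].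

Lemma glue_homo p q m (f : {ffun 'I_p -> 'I_m}) (g : {ffun 'I_q -> 'I_m}) :
  {homo f : x y / x < y} -> {homo g : x y / x < y} ->
  (forall x y, f x < g y) -> {homo glue f g : x y / x < y}.
Proof.
move=> hf hg fg x y; rewrite !ffunE.
case: (splitP x) => x' ->; case: (splitP y) => y' -> lt_xy.
- exact: hf.
- exact: fg.
- by have := ltn_ord y'; lia.
- by apply: hg; lia.
Qed.

Section Block.

Variables (k1 l1 k2 l2 : nat) (A : 'M[bool]_(k1, l1)) (B : 'M[bool]_(k2, l2)).
Let P := block_mx A (const_mx false) (const_mx false) B.

(** The zero blocks of [P] require nothing of [M], so only the relative position of the two copies
    matters. *)
Lemma block_contains m n (M : 'M[bool]_(m, n)) rA cA rB cB :
  occurs A M rA cA -> occurs B M rB cB ->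
  (forall x y, rA x < rB y) -> (forall x y, cA x < cB y) -> contains P M.
Proof.
move=> [hrA hcA HA] [hrB hcB HB] rAB cAB.
apply/containsP; exists (glue rA rB), (glue cA cB).
split=> [||x y]; [exact: glue_homo|exact: glue_homo|].
rewrite -(splitK x) -(splitK y) !ffunE !unsplitK /P.
case: (split x) => x'; case: (split y) => y' /=.
- by rewrite block_mxEul; apply: HA.
- by rewrite block_mxEur mxE.
- by rewrite block_mxEdl mxE.
- by rewrite block_mxEdr; apply: HB.
Qed.

(* The new entry plays the role of an entry of [A] or of [B]; the other block
   then already occurs in [M], strictly to one side of that entry. *)
Lemma block_contains_set_one m n (M : 'M[bool]_(m, n)) (i : 'I_m) (j : 'I_n) :
  ~~ contains P M -> contains P (set_one M i j) ->
  (exists r c, [/\ occurs B M r c, forall x, i < r x & forall y, j < c y]) \/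
  (exists r c, [/\ occurs A M r c, forall x, r x < i & forall y, c y < j]).
Proof.
move=> avM /containsP[r [c [hr hc H]]].
(* If no required one of the copy sat on [(i, j)], the copy would already lie in [M]. *)
have [x [y [Pxy rx cy]]] : exists x y, [/\ P x y, r x = i & c y = j].
  have [/existsP[x /existsP[y /and3P[? /eqP ? /eqP ?]]]|no] :=
    boolP [exists x, exists y, [&& P x y, r x == i & c y == j]].
    by exists x, y.
  case/negP: avM; apply/containsP; exists r, c; split=> // x y Pxy.
  have := H x y Pxy; rewrite mxE => /orP[/eqP[rx cy]|//].
  by case/existsP: no; exists x; apply/existsP; exists y; rewrite Pxy rx cy !eqxx.
move: Pxy rx cy; rewrite -(splitK x) -(splitK y) /P.
case: (split x) => x'; case: (split y) => y' /=.
(* The new entry serves [A]. The part of the copy indexed by [B] starts after row [i] and column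
   [j], so it misses the new entry and lies in [M]. *)
- move=> _ rx cy; left.
  exists [ffun u => r (rshift k1 u)], [ffun u => c (rshift l1 u)].
  have ri u : i < r (rshift k1 u).
    by rewrite -rx; apply: hr; rewrite /= ltn_addr.
  have cj u : j < c (rshift l1 u).
    by rewrite -cy; apply: hc; rewrite /= ltn_addr.
  split=> [|u|u]; rewrite ?ffunE //.
  split=> [u v uv|u v uv|u v Buv]; rewrite !ffunE.
  + by apply: hr; rewrite /= ltn_add2l.
  + by apply: hc; rewrite /= ltn_add2l.
  + have := H (rshift k1 u) (rshift l1 v); rewrite /P block_mxEdr mxE.
    case/(_ Buv)/orP => [/eqP[ru _]|//].
    by have := ri u; rewrite ru ltnn.
- by rewrite block_mxEur mxE.
- by rewrite block_mxEdl mxE.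
move=> _ rx cy; right.
exists [ffun u => r (lshift k2 u)], [ffun u => c (lshift l2 u)].
have ri u : r (lshift k2 u) < i.
  by rewrite -rx; apply: hr; rewrite /= ltn_addr.
have cj u : c (lshift l2 u) < j.
  by rewrite -cy; apply: hc; rewrite /= ltn_addr.
split=> [|u|u]; rewrite ?ffunE //.
split=> [u v uv|u v uv|u v Buv]; rewrite !ffunE.
+ exact: hr.
+ exact: hc.
have := H (lshift k2 u) (lshift l2 v); rewrite /P block_mxEul mxE.
case/(_ Buv)/orP => [/eqP[ru _]|//].
by have := ri u; rewrite ru ltnn.
Qed.

Hypotheses (A_neq0 : A != const_mx false) (B_neq0 : B != const_mx false).

Lemma block_neq0 : P != const_mx false.
Proof.
have [x [y Axy]] := neq0_entry A_neq0; apply/eqP => /matrixP.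
by move=> /(_ (lshift k2 x) (lshift l2 y)); rewrite block_mxEul mxE Axy.
Qed.

Lemma block_saturating_column m n (M : 'M[bool]_(m, n)) (j : 'I_n) :
  0 < m -> saturating P M -> exists i, M i j.
Proof.
move=> m_gt0 /andP[avM /forallP satM].
have [/existsP//|/existsPn Mj0] := boolP [exists i, M i j].
have [xA _] := neq0_entry A_neq0; have [xB _] := neq0_entry B_neq0.
have side i := block_contains_set_one avM
  (implyP (forallP (satM i) j) (Mj0 i)).
(* No row can switch kind: a copy of [B] below row [i] and a copy of [A] above row [i.+1], hence in
   rows up to [i], would form [P]. At row [0] the index [xA] rules out a copy of [A]. *)
have below i : i < m -> exists r c,
    [/\ occurs B M r c, forall x, i < r x & forall y, j < c y].
  elim: i => [|i IH] im.
    case: (side (Ordinal im)) => [//|[r [c [_ /(_ xA)]]]] //.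
  case: (side (Ordinal im)) => [//|[rA [cA [occA rAi cAj]]]].
  have [rB [cB [occB rBi cBj]]] := IH (ltnW im).
  case/negP: avM; apply: block_contains occA occB _ _ => x y.
    exact: leq_ltn_trans (ltnSE (rAi x)) (rBi y).
  exact: ltn_trans (cAj x) (cBj y).
(* In the last row, the row [r xB] of the copy of [B] would lie outside the matrix. *)
have [r [c [_ /(_ xB)]]] := below m.-1 ltac:(by rewrite prednK).
by have := ltn_ord (r xB); lia.
Qed.

Lemma block_sat_geq n : n <= sat P n n.
Proof.
have [->//|n_gt0] := posnP n.
have [M satM ->] := satP n n block_neq0; rewrite -[leqLHS]card_ord /weight.
(* As no column is empty, projecting the ones to their column indices is onto. *)
set S := [set _ | _]; apply: leq_trans (leq_imset_card snd S).
apply/subset_leq_card/subsetP => j _.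
have [i Mij] := block_saturating_column j n_gt0 satM.
by apply/imsetP; exists (i, j); rewrite ?inE.
Qed.

End Block.

(* Required only here: [all_classical] shadows the [finset] names used above. *)
From mathcomp Require Import all_classical all_reals all_analysis.

Import GRing.Theory Num.Theory.
Import numFieldNormedType.Exports.
Local Open Scope classical_set_scope.
Local Open Scope ring_scope.

Lemma linear_bounds_Theta (R : realType) (u : nat -> nat) (C : nat) :
  (forall n, (n <= u n <= C * n)%N) ->
  (fun n : nat => (u n)%:R : R^o) =Theta_\oo (fun n : nat => n%:R : R^o).
Proof.
move=> bnd; rewrite eqThetaE qualifE; apply/asboolP.
(* [C.+1] instead of [C] keeps the upper constant positive even for [C = 0]. *)
exists (1, C.+1%:R) => /=; first by rewrite ltr01 ltr0n.
apply: nearW => n; rewrite !normr_nat mul1r -natrM !ler_nat.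
have /andP[-> uC] := bnd n; split=> //.
by rewrite (leq_trans uC) // leq_mul2r leqnSn orbT.
Qed.

Theorem theorem5 (R : realType) (k1 l1 k2 l2 : nat)
    (A : 'M[bool]_(k1, l1)) (B : 'M[bool]_(k2, l2))
    (A_neq0 : A != const_mx false) (B_neq0 : B != const_mx false) :
  let P := block_mx A (const_mx false) (const_mx false) B in
  (fun n : nat => (sat P n n)%:R : R^o) =Theta_\oo (fun n : nat => n%:R : R^o).
Proof.
move=> P; have le_sat := sat_leq_linear (block_neq0 B A_neq0).
apply: linear_bounds_Theta => n; apply/andP.
by split; [exact: block_sat_geq|exact: le_sat].
Qed.
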